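(* Let $K\in L_0(\Omega\times\Omega')$ be a kernel whose right-sided kernel set $\{K(x,\cdot):x\in\Omega\}$ is linearly independent, and let $\operatorname{span}\{K(x,\cdot):x\in\Omega\}$ be endowed with a norm $\|\cdot\|_K$. Suppose that its completion $\mathcal{F}$, a space of functions on $\Omega'$, is reflexive and that the point evaluation functionals $\delta_y$ are continuous on $\mathcal{F}$ for all $y\in\Omega'$. Let $\Delta_K:=\operatorname{span}\{\delta_x:x\in\Omega\}$ be the space of finite linear combinations of point evaluation functionals on $L_0(\Omega)$, normed by $$\Big\|\sum_{k=1}^Nc_k\delta_{x_k}\Big\|_K:=\Big\|\sum_{k=1}^Nc_kK(x_k,\cdot)\Big\|_K$$ for pairwise distinct $x_1,\dots,x_N\in\Omega$. Then the space $$\mathcal{B}:=\{f\in L_0(\Omega):\ \exists\,C_f>0\text{ such that }|\lambda(f)|\le C_f\|\lambda\|_K\text{ for all }\lambda\in\Delta_K\},\qquad\|f\|_{\mathcal{B}}:=\sup_{\lambda\in\Delta_K,\,\lambda\ne0}\frac{|\lambda(f)|}{\|\lambda\|_K},$$ is a two-sided reproducing kernel Banach space with the two-sided reproducing kernel $K$, and the dual space $\mathcal{B}'$ of $\mathcal{B}$ is isometrically equivalent to $\mathcal{F}$.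
   Context: $\Omega,\Omega'$ are locally compact Hausdorff spaces equipped with regular Borel measures $\mu,\mu'$. $L_0(X)$ denotes the set of real-valued measurable functions on $X$ (genuine functions); $\delta_x(f):=f(x)$. Linear independence of the kernel set means that for any pairwise distinct $x_1,\dots,x_N\in\Omega$, $\sum_kc_kK(x_k,\cdot)=0$ implies all $c_k=0$. For a Banach space $\mathcal{B}$, $\mathcal{B}'$ is its continuous dual and $\langle f,G\rangle_{\mathcal{B}}:=G(f)$. ''Isometrically equivalent'' means isometrically isomorphic. Two-sided reproducing kernel Banach space: let $K\in L_0(\Omega\times\Omega')$ and let $\mathcal{B}$ be a Banach space consisting of functions in $L_0(\Omega)$ whose dual $\mathcal{B}'$ is isometrically isomorphic to a normed space $\mathcal{F}$ consisting of functions in $L_0(\Omega')$, identified with $\mathcal{B}'$. $\mathcal{B}$ is a two-sided reproducing kernel Banach space with two-sided reproducing kernel $K$ if (i) $K(x,\cdot)\in\mathcal{F}\cong\mathcal{B}'$ for each $x\in\Omega$; (ii) $\langle f,K(x,\cdot)\rangle_{\mathcal{B}}=f(x)$ for all $f\in\mathcal{B}$, $x\in\Omega$; (iii) $K(\cdot,y)\in\mathcal{B}$ for each $y\in\Omega'$; (iv) $\langle K(\cdot,y),g\rangle_{\mathcal{B}}=g(y)$ for all $g\in\mathcal{F}$, $y\in\Omega'$. *)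

(* Defs.v *)
From HB Require Import structures.
From mathcomp Require Import all_boot all_order all_algebra.
From mathcomp Require Import all_classical all_reals all_analysis.

Set Implicit Arguments.
Unset Strict Implicit.
Unset Printing Implicit Defensive.

Import Order.TTheory GRing.Theory Num.Theory.
Import numFieldNormedType.Exports.

Local Open Scope classical_set_scope.
Local Open Scope ring_scope.

Notation borelType T := (g_sigma_algebraType (@open T)).

(* Authors disagree on whether regularity also includes finiteness on compact
   sets or inner regularity of all Borel sets; the two clauses below are those
   common to the usual definitions. *)
Definition regular_borel (R : realType) (T : ptopologicalType)
    (mu : {measure set (borelType T) -> \bar R}) : Prop :=
  (forall A : set (borelType T), measurable A ->
     mu A = ereal_inf [set mu U | U in [set U : set T | open U /\ A `<=` U]]) /\
  (forall U : set T, open U ->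
     mu U = ereal_sup [set mu C | C in [set C : set T | compact C /\ C `<=` U]]).

(* Elements are functions, not classes modulo almost-everywhere equality.
   On a product the Borel sets are those of the product topology; they
   include the product of the two Borel sigma-algebras. *)
Notation L0 R T := {mfun borelType T >-> R}.

Definition lspan (R : nzRingType) (V : lmodType R) (A : set V) : set V :=
  [set v | exists (n : nat) (c : 'I_n -> R) (a : 'I_n -> V),
     (forall i, A (a i)) /\ v = \sum_(i < n) c i *: a i].

Definition is_norm_on (R : realType) (V : lmodType R) (S : set V) (N : V -> R)
    : Prop :=
  [/\ forall u v, S u -> S v -> N (u + v) <= N u + N v,
      forall c u, S u -> N (c *: u) = `|c| * N u &
      forall u, S u -> N u = 0 -> u = 0].

Section Dual.
Context {R : realType} (E : normedModType R).

Definition dual_pred : {pred E -> R} :=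
  mem [set f : E -> R | linear f /\ continuous f].

Record dual := Dual { dual_fun :> E -> R ; dual_funP : dual_fun \in dual_pred }.

HB.instance Definition _ := [isSub of dual for dual_fun].
HB.instance Definition _ := [Choice of dual by <:].

Lemma dual_submod_closed : submod_closed dual_pred.
Proof.
split=> [|a f g]; rewrite !inE /=.
  split=> [b x y|x]; first by rewrite /= scaler0 addr0.
  exact: cst_continuous.
move=> -[lf cf] [lg cg]; split=> [b x y|x].
  rewrite !fctE lf lg !scalerDr !scalerA [a * b]mulrC -!addrA; congr (_ + _).
  by rewrite addrCA.
apply: continuousD; last exact: cg.
by apply: continuousZr; exact: cf.
Qed.

HB.instance Definition _ :=
  GRing.isSubmodClosed.Build R (E -> R) dual_pred dual_submod_closed.
HB.instance Definition _ := [SubChoice_isSubLmodule of dual by <:].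

Lemma dual_linear (f : dual) : linear f.
Proof. by have := dual_funP f; rewrite inE => -[]. Qed.

Lemma dual_continuous (f : dual) : continuous f.
Proof. by have := dual_funP f; rewrite inE => -[]. Qed.

Definition dual_norm (f : dual) : R := sup [set `|f x| | x in [set x | `|x| <= 1]].

Let dual_lin (f : dual) : {linear E -> R} :=
  HB.pack (f : E -> R) (GRing.isLinear.Build R E R _ (f : E -> R) (dual_linear f)).

Lemma dual_has_sup (f : dual) :
  has_sup [set `|f x| | x in [set x | `|x| <= 1]].
Proof.
split; first by exists `|f 0|, 0 => //=; rewrite normr0.
have cf : continuous (dual_lin f) by exact: dual_continuous.
have /linear_boundedP [r [_ rf]] := @continuous_linear_bounded _ _ _ 0 _ (cf 0).
have r1 : r < `|r| + 1 by apply: le_lt_trans (ler_norm r) _; rewrite ltrDl.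
exists (`|r| + 1) => _ [x /= x1 <-].
apply: le_trans (rf _ r1 x) _.
by rewrite ler_piMr// addr_ge0.
Qed.

Lemma dual_norm_ub (f : dual) x : `|x| <= 1 -> `|f x| <= dual_norm f.
Proof.
by move=> x1; apply: sup_upper_bound; [exact: dual_has_sup|exists x].
Qed.

Lemma dual_norm_le (f : dual) (M : R) :
  (forall x, `|x| <= 1 -> `|f x| <= M) -> dual_norm f <= M.
Proof.
move=> fM; apply: ge_sup; first by have [] := dual_has_sup f.
by move=> _ [x /= x1 <-]; exact: fM.
Qed.

Lemma dual_normD f g : dual_norm (f + g) <= dual_norm f + dual_norm g.
Proof.
apply: dual_norm_le => x x1 /=; apply: le_trans (ler_normD _ _) _.
by apply: lerD; exact: dual_norm_ub.
Qed.

Lemma dual_normZ (a : R) f : dual_norm (a *: f) = `|a| * dual_norm f.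
Proof.
have le b g : dual_norm (b *: g) <= `|b| * dual_norm g.
  apply: dual_norm_le => x x1 /=.
  by rewrite normrM ler_wpM2l// dual_norm_ub.
apply/eqP; rewrite eq_le le /=.
have [->|a0] := eqVneq a 0.
  rewrite normr0 mul0r scale0r.
  by apply: le_trans (@dual_norm_ub 0 0 _); rewrite ?normr0.
have := le a^-1 (a *: f); rewrite scalerA mulVf// scale1r normfV.
by rewrite mulrC ler_pdivlMr ?normr_gt0// mulrC.
Qed.

Lemma dual_norm_eq0 f : dual_norm f = 0 -> f = 0.
Proof.
move=> f0; apply/val_inj/funext => x /=.
have [->|x0] := eqVneq x 0; first exact: (linear0 (dual_lin f)).
have nx0 : `|x| != 0 by rewrite normr_eq0.
have -> : x = `|x| *: (`|x|^-1 *: x) by rewrite scalerA mulfV// scale1r.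
have /= -> := linearZ_LR (dual_lin f) `|x| (`|x|^-1 *: x).
suff -> : f (`|x|^-1 *: x) = 0 by rewrite scaler0.
apply/eqP; rewrite -normr_le0 -f0 dual_norm_ub//.
by rewrite normrZ normfV normr_id mulVf.
Qed.

HB.instance Definition _ :=
  Lmodule_isNormed.Build R dual dual_normD dual_normZ dual_norm_eq0.

End Dual.

(* Surjectivity of the canonical embedding into the bidual. *)
Definition reflexive_space (R : realType) (E : normedModType R) : Prop :=
  forall Phi : dual (dual E), exists v : E, forall phi : dual E, Phi phi = phi v.

Definition is_isometric_iso (R : realType) (V W : normedModType R)
    (T : {linear V -> W}) : Prop :=
  bijective T /\ forall v, `|T v| = `|v|.

Definition isometrically_equivalent (R : realType) (V W : normedModType R) :
  Prop := exists T : {linear V -> W}, is_isometric_iso T.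

(* In what follows a Banach (or normed) space of functions on X is an abstract
   space E with an injective linear map ev : E -> (X -> R), where ev v is v
   viewed as a function. *)

Definition is_completion_of (R : realType) (X : Type) (S : set (X -> R))
    (N : (X -> R) -> R) (F : completeNormedModType R)
    (ev : {linear F -> (X -> R)}) : Prop :=
  [/\ injective ev,
      S `<=` range ev,
      forall g, S (ev g) -> `|g| = N (ev g) &
      dense (ev @^-1` S)].

Section Kernel.
Context {R : realType} {Om Om' : ptopologicalType}.
Variable K : L0 R (Om * Om')%type.

Definition kerr (x : Om) : Om' -> R := fun y => K (x, y).
Definition kerl (y : Om') : Om -> R := fun x => K (x, y).

Definition kerr_linear_independent : Prop :=
  forall (n : nat) (x : 'I_n -> Om) (c : 'I_n -> R), injective x ->
    \sum_(k < n) c k *: kerr (x k) = 0 -> forall k, c k = 0.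

Definition kerr_span : set (Om' -> R) := lspan (range kerr).

Definition eval_at (x : Om) : L0 R Om -> R := fun f => f x.

Definition Delta : set (L0 R Om -> R) := lspan (range eval_at).

Variable N : (Om' -> R) -> R.

(* N is the norm on kerr_span. Delta_normE shows that the value does not depend
   on which representation of lambda by pairwise distinct points is used. *)
Definition Delta_norm (lambda : L0 R Om -> R) : R :=
  xget 0 [set r | exists (n : nat) (x : 'I_n -> Om) (c : 'I_n -> R),
    [/\ injective x,
        lambda = \sum_(k < n) c k *: eval_at (x k) &
        r = N (\sum_(k < n) c k *: kerr (x k))]].

Definition B_set : set (L0 R Om) :=
  [set f | exists2 C : R, 0 < C &
     forall lambda, Delta lambda -> `|lambda f| <= C * Delta_norm lambda].

Definition B_norm (f : L0 R Om) : R :=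
  sup [set `|lambda f| / Delta_norm lambda |
       lambda in [set lambda | Delta lambda /\ lambda != 0]].

Lemma kerl_measurable y : measurable_fun [set: borelType Om] (kerl y).
Proof.
move=> _ A mA; rewrite setTI.
have mK : measurable (K @^-1` A).
  by rewrite -[X in measurable X]setTI; exact: measurable_funPT.
have mp : measurable_fun [set: borelType Om]
    ((fun x => (x, y)) : borelType Om -> borelType (Om * Om')%type).
  apply: (@measurability _ _ (borelType Om) (borelType (Om * Om')%type) _ _
    (@open (Om * Om')%type)) => //.
  move=> _ [U oU <-]; rewrite setTI; apply: sub_sigma_algebra.
  apply: open_comp oU => x _.
  by apply: cvg_pair => /=; [exact: cvg_id|exact: cvg_cst].
by have := mp measurableT _ mK; rewrite setTI.
Qed.

Lemma Delta_normE n (x : 'I_n -> Om) (c : 'I_n -> R) : injective x ->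
  Delta_norm (\sum_(k < n) c k *: eval_at (x k)) =
  N (\sum_(k < n) c k *: kerr (x k)).
Proof.
move=> xi; apply: xget_unique; first by exists n, x, c.
move=> _ [m [z [d [zi e ->]]]]; congr N; apply/funext => y.
have /= := congr1 (fun l => l (mfun_Sub (mem_set (kerl_measurable y)))) e.
by rewrite !fct_sumE /= => /esym.
Qed.

End Kernel.

Definition two_sided_RKBS (R : realType) (Om Om' : ptopologicalType)
    (K : L0 R (Om * Om')%type)
    (B : completeNormedModType R) (evB : {linear B -> (Om -> R)})
    (F : normedModType R) (evF : {linear F -> (Om' -> R)}) : Prop :=
  [/\ injective evB /\ (forall f, measurable_fun [set: borelType Om] (evB f)),
      injective evF /\ (forall g, measurable_fun [set: borelType Om'] (evF g)) &
      exists2 T : {linear F -> dual B}, is_isometric_iso T &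
      [/\ forall x, exists g, evF g = kerr K x,
          forall f x g, evF g = kerr K x -> T g f = evB f x,
          forall y, exists f, evB f = kerl K y &
          forall g y f, evB f = kerl K y -> T g f = evF g y]].

(* Main.v *)
(**
The space B is realised as the dual of F, a functional phi being read as the
function x |-> phi (K(x, .)). Boundedness of f on Delta_K means that
K(x, .) |-> f x defines a bounded functional on the span of the K(x, .), which
extends to F by Hahn-Banach, and density of that span gives the norm formula.
Measurability of x |-> phi (K(x, .)) is where reflexivity enters: the
evaluations delta_y separate the points of F, so by reflexivity their span is
norm dense in F', and phi is a pointwise limit of combinations of the measurable
functions K(., y). Finally B' = F'' is F, through the canonical embedding.
*)
Require Import Defs.
From HB Require Import structures.
From mathcomp Require Import all_boot all_order all_algebra.
From mathcomp Require Import all_classical all_reals all_analysis.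
From mathcomp Require Import measurable_realfun lra.

Set Implicit Arguments.
Unset Strict Implicit.
Unset Printing Implicit Defensive.

Import Order.TTheory GRing.Theory Num.Theory.
Import numFieldNormedType.Exports.

Local Open Scope classical_set_scope.
Local Open Scope ring_scope.

Lemma scaleRE (R : realType) (a b : R) : a *: b = a * b.
Proof. by []. Qed.

(** * Hahn-Banach extension below a sublinear map *)

Section HahnBanach.
Context {R : realType} {V : lmodType R}.
Implicit Types (G : set (V * R)) (p : V -> R).

(* A linear graph dominated by a sublinear map is single-valued, so partial
   linear functionals can be handled as plain sets of pairs. *)
Definition linear_graph G : Prop := forall a u v, G u -> G v -> G (a *: u + v).

Definition dominated_graph p G : Prop := forall v, G v -> v.2 <= p v.1.

Lemma linear_graphZ G a u : linear_graph G -> G u -> G (a *: u).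
Proof.
move=> lG Gu; have G0 : G 0.
  by have := lG (-1) u u Gu Gu; rewrite scaleN1r addNr.
by have := lG a u 0 Gu G0; rewrite addr0.
Qed.

Variables (p : V -> R).
Hypotheses (pD : forall u v, p (u + v) <= p u + p v)
  (pZ : forall (c : R) v, 0 < c -> p (c *: v) = c * p v).

(* The admissible values at [x] lie between the supremum of [r - p (v - x)] and
   the infimum of [p (v + x) - r] over the pairs [(v, r)] of the graph. *)
Lemma dominated_graph_step G x : G !=set0 -> linear_graph G ->
  dominated_graph p G ->
  exists G', [/\ G `<=` G', linear_graph G', dominated_graph p G' &
    exists r, G' (x, r)].
Proof.
move=> [u0 Gu0] lG dG.
have G0 : G 0 by have := linear_graphZ 0 lG Gu0; rewrite scale0r.
(* By linearity and domination u.2 + v.2 <= p (u.1 + v.1), and u.1 + v.1 is split as (u.1 - x) +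
   (v.1 + x). *)
have sep u v : G u -> G v -> u.2 - p (u.1 - x) <= p (v.1 + x) - v.2.
  move=> Gu Gv; rewrite lerBlDr addrAC lerBrDr.
  have := lG 1 u v Gu Gv; rewrite scale1r => /dG /= /le_trans; apply.
  by apply: le_trans (pD _ _); rewrite addrACA subrr addr0 [v.1 + _]addrC.
pose L := [set u.2 - p (u.1 - x) | u in G].
have L0 : L !=set0 by exists ((0 : V * R).2 - p ((0 : V * R).1 - x)), 0.
pose al := sup L.
have alub u : G u -> u.2 - p (u.1 - x) <= al.
  move=> Gu; apply: sup_upper_bound; last by exists u.
  split=> //; exists (p ((0 : V * R).1 + x) - (0 : V * R).2) => _ [w Gw <-].
  exact: sep.
have alle v : G v -> al <= p (v.1 + x) - v.2.
  by move=> Gv; apply: ge_sup => // _ [u Gu <-]; exact: sep.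
exists [set w | exists2 u, G u & exists c, w = u + c *: (x, al)]; split.
- by move=> u Gu; exists u => //; exists 0; rewrite scale0r addr0.
- move=> a _ _ [u Gu [c ->]] [v Gv [d ->]].
  exists (a *: u + v); first exact: lG.
  by exists (a * c + d); rewrite scalerDr scalerA scalerDl addrACA.
(* For c < 0 the lower bound on [al] is used, for c > 0 the upper one, after rescaling u by
   1/|c|. *)
- move=> _ [u Gu [c ->]] /=; have [c0|c0|->] := ltgtP c 0.
  + have d0 : 0 < - c by rewrite oppr_gt0.
    rewrite -[c]opprK; set d := - c in d0 *.
    have := alub _ (linear_graphZ d^-1 lG Gu).
    rewrite /= !scaleRE => h.
    have -> : u.1 + - d *: x = d *: (d^-1 *: u.1 - x).
      by rewrite scalerBr scalerA mulfV ?gt_eqF// scale1r scaleNr.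
    by rewrite pZ// -ler_pdivrMl// mulNr mulrBr mulKf ?gt_eqF//; lra.
  + have := alle _ (linear_graphZ c^-1 lG Gu).
    rewrite /= !scaleRE => h.
    have -> : u.1 + c *: x = c *: (c^-1 *: u.1 + x).
      by rewrite scalerDr scalerA mulfV ?gt_eqF// scale1r.
    by rewrite pZ// -ler_pdivrMl// mulrDr mulKf ?gt_eqF//; lra.
  + by rewrite !scale0r !addr0; exact: dG.
- by exists al; exists 0 => //; exists 1; rewrite scale1r add0r.
Qed.

Theorem hahn_banach G : G !=set0 -> linear_graph G -> dominated_graph p G ->
  exists f : V -> R,
    [/\ linear f, forall v, f v <= p v & forall v, G v -> f v.1 = v.2].
Proof.
move=> Gn lG dG.
(* The graph [G] is joined to H because Zorn's lemma also covers the empty chain, whose union is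
   empty. *)
pose P (H : set (V * R)) :=
  linear_graph (G `|` H) /\ dominated_graph p (G `|` H).
have [H [[lH dH] Hmax]] : exists A, P A /\ forall B, A `<` B -> ~ P B.
  apply: Zorn_bigcup => C CP Ctot; split.
  - have key u v : (G `|` \bigcup_(X in C) X) u ->
        (G `|` \bigcup_(X in C) X) v ->
        (G u /\ G v) \/ exists2 X, C X & (G `|` X) u /\ (G `|` X) v.
      move=> [Gu|[X CX Xu]] [Gv|[Y CY Yv]].
      + by left.
      + by right; exists Y => //; split; [left|right].
      + by right; exists X => //; split; [right|left].
      + have [XY|YX] := Ctot _ _ CX CY.
          by right; exists Y => //; split; right => //; exact: XY.
        by right; exists X => //; split; right => //; exact: YX.
    move=> a u v /key h /h [[Gu Gv]|[X CX [Xu Xv]]].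
      by left; exact: lG.
    by have [lX _] := CP _ CX; case: (lX a _ _ Xu Xv); [left|right; exists X].
  - move=> v [/dG//|[X CX Xv]].
    by have [_ dX] := CP _ CX; apply: dX; right.
(* A maximal graph is defined everywhere: a one-step extension at a missing x would be strictly
   larger. *)
have tot x : exists r, (G `|` H) (x, r).
  have [|G' [sub lG' dG' [r G'r]]] := dominated_graph_step x _ lH dH.
    by case: Gn => u Gu; exists u; left.
  have GG' : G `|` G' = G' by apply/setUidPr => u Gu; apply: sub; left.
  exists r; apply: contrapT => nr; apply: (Hmax G'); last by split; rewrite GG'.
  split=> [u Hu|G'H]; first by apply: sub; right.
  by apply: nr; right; exact: G'H.
have [f fP] := choice tot.
(* Two values s, t over one point put (0, t - s) in the graph, so t - s <= p 0; homogeneity at 2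
   gives p 0 = 0. *)
have uniq v r : (G `|` H) (v, r) -> f v = r.
  have p0 : p 0 = 0.
    by have := @pZ 2 0; rewrite ltr0n scaler0 => /(_ isT); lra.
  suff le u s t : (G `|` H) (u, s) -> (G `|` H) (u, t) -> t <= s.
    by move=> Hr; apply/eqP; rewrite eq_le !(@le v).
  move=> Hs Ht.
  have : -1 * s + t <= p (-1 *: u + u) := dH _ (lH (-1) _ _ Hs Ht).
  by rewrite scaleN1r addNr p0; lra.
exists f; split.
- by move=> a u v; apply: uniq; exact: (lH a (u, f u) (v, f v)).
- by move=> v; exact: dH (fP v).
- by move=> [v r] Gv; apply: uniq; left.
Qed.

End HahnBanach.

(** * Bounded functionals: extension, norming, separation *)

Section BoundedFunctionals.
Context {R : realType} {E : normedModType R}.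

Lemma bounded_linear_dual (f : E -> R) (C : R) : linear f ->
  (forall v, `|f v| <= C * `|v|) -> exists phi : dual E, phi = f :> (E -> R).
Proof.
move=> lf fC.
pose fl : {linear E -> R} :=
  HB.pack (f : E -> R) (GRing.isLinear.Build R E R _ (f : E -> R) lf).
have cf : continuous fl.
  apply/bounded_linear_continuous/linear_boundedP.
  exists C; split=> [|r Cr x]; first exact: num_real.
  by apply: le_trans (fC x) _; rewrite ler_wpM2r// ltW.
have fP : f \in (@dual_pred R E) by rewrite inE.
by exists (Dual fP).
Qed.

Lemma dualD (phi : dual E) u v : phi (u + v) = phi u + phi v.
Proof. by have := dual_linear phi 1 u v; rewrite !scale1r. Qed.

Lemma dual0 (phi : dual E) : phi 0 = 0.
Proof. by have := dual_linear phi (-1) 0 0; rewrite !scaleN1r !addNr. Qed.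

Lemma dualZ (phi : dual E) a u : phi (a *: u) = a * phi u.
Proof. by have := dual_linear phi a u 0; rewrite dual0 !addr0. Qed.

Lemma dualB (phi : dual E) u v : phi (u - v) = phi u - phi v.
Proof. by rewrite dualD -scaleN1r dualZ mulN1r. Qed.

Lemma dual_norm_bound (phi : dual E) v : `|phi v| <= `|phi| * `|v|.
Proof.
have [->|v0] := eqVneq v 0; first by rewrite dual0 !normr0 mulr0.
rewrite -ler_pdivrMr ?normr_gt0//.
have := @dual_norm_ub _ _ phi (`|v|^-1 *: v).
rewrite normrZ normfV normr_id mulVf ?normr_eq0// => /(_ (lexx _)).
by rewrite dualZ normrM normfV normr_id mulrC.
Qed.

Lemma dual_norm_le_bound (phi : dual E) (C : R) : 0 <= C ->
  (forall v, `|phi v| <= C * `|v|) -> `|phi| <= C.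
Proof.
move=> C0 phiC; apply: dual_norm_le => x x1.
by apply: le_trans (phiC x) _; rewrite ler_piMr.
Qed.

(** The sublinear map C |v| is even, so the bound at -v also bounds f from below. The estimate on
    [G] forces it to be single-valued, so this is never checked separately. *)
Lemma hahn_banach_dual (C : R) (G : set (E * R)) : 0 <= C -> G !=set0 ->
  linear_graph G -> (forall v, G v -> `|v.2| <= C * `|v.1|) ->
  exists2 phi : dual E, `|phi| <= C & forall v, G v -> phi v.1 = v.2.
Proof.
move=> C0 Gn lG dG.
have [] := @hahn_banach R E (fun v => C * `|v|) _ _ G Gn lG _.
- by move=> u v; rewrite -mulrDr ler_wpM2l// ler_normD.
- by move=> c v c0; rewrite normrZ gtr0_norm// mulrCA.
- by move=> v Gv; apply: le_trans (dG v Gv); exact: ler_norm.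
move=> f [lf fC fG].
have fCn v : `|f v| <= C * `|v|.
  rewrite ler_norml fC andbT lerNl -(normrN v).
  have f0 : f 0 = 0 by have := lf (-1) 0 0; rewrite !scaleN1r !addNr.
  have := lf (-1) v 0; rewrite !scaleN1r f0 !addr0 => <-; exact: fC.
have [phi phiE] := bounded_linear_dual lf fCn.
exists phi => [|v Gv]; last by rewrite phiE fG.
by apply: dual_norm_le_bound => // v; rewrite phiE.
Qed.

(** Extends c v |-> c |v| from the line through v. *)
Lemma norming_functional (v : E) :
  exists2 phi : dual E, `|phi| <= 1 & phi v = `|v|.
Proof.
have [] :=
  @hahn_banach_dual 1 (range (fun c : R => (c *: v, c * `|v|))) _ _ _ _.
- exact: ler01.
- by exists (0 *: v, 0 * `|v|), 0.
- move=> a _ _ [c _ <-] [d _ <-]; exists (a * c + d) => //.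
  by rewrite scalerDl mulrDl -scalerA -mulrA.
- by move=> _ [c _ <-] /=; rewrite mul1r normrM normr_id normrZ.
move=> phi phi1 phiG; exists phi => //.
apply: (phiG (v, `|v|)); exists 1 => //.
by rewrite scale1r mul1r.
Qed.

(** The functional w + c x |-> c on the span of [W] and x is bounded by 1/e, because w + c x = c (x
    - w') with w' in [W] when c is nonzero. *)
Lemma separating_functional (W : set E) (x : E) (e : R) : 0 < e -> W !=set0 ->
  (forall a u v, W u -> W v -> W (a *: u + v)) ->
  (forall w, W w -> e <= `|x - w|) ->
  exists2 phi : dual E, phi x = 1 & forall w, W w -> phi w = 0.
Proof.
move=> e0 [w0 Ww0] lW eW.
have W0 : W 0 by have := lW (-1) _ _ Ww0 Ww0; rewrite scaleN1r addNr.
have WZ a w : W w -> W (a *: w).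
  by move=> Ww; have := lW a _ _ Ww W0; rewrite addr0.
have [] := @hahn_banach_dual e^-1
  [set z | exists2 w, W w & exists c : R, z = (w + c *: x, c)] _ _ _ _.
- by rewrite invr_ge0 ltW.
- by exists (0 + 0 *: x, 0), 0 => //; exists 0.
- move=> a _ _ [u Wu [c ->]] [v Wv [d ->]].
  exists (a *: u + v); first exact: lW.
  exists (a * c + d); congr pair => /=.
  by rewrite scalerDr scalerA scalerDl addrACA.
- move=> _ [w Ww [c ->]] /=; rewrite mulrC ler_pdivlMr//.
  have [->|c0] := eqVneq c 0; first by rewrite normr0 mul0r.
  have -> : w + c *: x = c *: (x - (- c^-1) *: w).
    by rewrite scalerBr scalerA mulrN mulfV// scaleN1r opprK addrC.
  by rewrite normrZ ler_wpM2l// eW//; exact: WZ.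
move=> phi _ phiG; exists phi => [|w Ww].
  by apply: (phiG (x, 1)); exists 0 => //; exists 1; rewrite scale1r add0r.
by apply: (phiG (w, 0)); exists w => //; exists 0; rewrite scale0r addr0.
Qed.

End BoundedFunctionals.

(** * Consequences for the dual and the bidual *)

Lemma reflexive_dense (R : realType) (E : normedModType R) (W : set (dual E)) :
  reflexive_space E -> W !=set0 ->
  (forall a u v, W u -> W v -> W (a *: u + v)) ->
  (forall v : E, (forall w : dual E, W w -> w v = 0) -> v = 0) ->
  forall (phi : dual E) (e : R), 0 < e -> exists2 w, W w & `|phi - w| < e.
Proof.
move=> rE W0 lW Wsep phi e e0; apply: contrapT => nW.
(* If [W] stays at distance e from phi, some [Phi] in the bidual vanishes on [W] and is 1 at phi. By
   reflexivity it is evaluation at some v, and [Wsep] forces v = 0. *)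
have [w Ww|Phi Phi1 PhiW] := separating_functional (x := phi) e0 W0 lW.
  by rewrite leNgt; apply/negP => h; apply: nW; exists w.
have [v vE] := rE Phi.
have v0 : v = 0 by apply: Wsep => w Ww; rewrite -vE PhiW.
by move: Phi1; rewrite vE v0 dual0 => /esym/eqP; rewrite oner_eq0.
Qed.

(** The bound |J v| <= |v| is immediate; the reverse one needs a norming functional for v. *)
Lemma canonical_embedding (R : realType) (E : normedModType R) :
  exists J : {linear E -> dual (dual E)},
    (forall v phi, J v phi = phi v) /\ forall v, `|J v| = `|v|.
Proof.
have ex v : exists Phi : dual (dual E),
    Phi = (fun phi => phi v) :> (dual E -> R).
  apply: (@bounded_linear_dual _ _ _ `|v|) => [a f g //|phi].
  by rewrite mulrC dual_norm_bound.
have [J JE] := choice ex.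
have lJ : linear J.
  move=> a u v; apply/val_inj/funext => phi /=.
  by rewrite JE -[RHS]/(a * J u phi + J v phi) !JE dualD dualZ.
pose Jl : {linear E -> dual (dual E)} :=
  HB.pack J (GRing.isLinear.Build R E (dual (dual E)) _ J lJ).
exists Jl; split=> v => [phi|]; first by rewrite /= JE.
apply/eqP; rewrite eq_le; apply/andP; split.
  by apply: dual_norm_le_bound => // phi; rewrite /= JE mulrC dual_norm_bound.
have [phi phi1 phiv] := norming_functional v.
have := dual_norm_bound (J v) phi; rewrite JE phiv ger0_norm// => h.
by apply: le_trans h _; rewrite ler_piMr.
Qed.

Lemma isometric_iso_inverse (R : realType) (V W : normedModType R)
    (J : {linear V -> W}) : is_isometric_iso J -> isometrically_equivalent W V.
Proof.
move=> [[g JK gK] Jn].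
have lg : linear g by move=> a u v; rewrite -{1}[u]gK -{1}[v]gK -linearP JK.
pose gl : {linear W -> V} := HB.pack g (GRing.isLinear.Build R W V _ g lg).
exists gl; split; first by exists J.
by move=> w; rewrite -Jn /= gK.
Qed.

(** * Completeness of the dual norm *)

Section DualComplete.
Context {R : realType} {E : normedModType R}.

(** The limit is taken pointwise in R; the estimates on small balls of the filter are uniform and
    pass to it. *)
Lemma dual_complete (G : set_system (dual E)) : ProperFilter G ->
  cauchy G -> cvg G.
Proof.
move=> PG /cauchyP cG.
have cvGx x : cvg ((phi : dual E) x @[phi --> G]).
  apply: cauchy_cvg; apply: cauchy_exP => e e0.
  have x1 : 0 < `|x| + 1 by rewrite ltr_wpDl.
  have [phi0 Gphi0] := cG (e / (`|x| + 1)) (divr_gt0 e0 x1).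
  exists (phi0 x); change (G (fun phi => ball (phi0 x) e (phi x))).
  apply: filterS Gphi0 => phi; rewrite -ball_normE /= => h.
  suff : `|phi0 x - phi x| < e by [].
  have /= := dual_norm_bound (phi0 - phi) x.
  move=> /le_lt_trans; apply.
  apply: (@le_lt_trans _ _ (`|phi0 - phi| * (`|x| + 1))).
    by rewrite ler_wpM2l// lerDl.
  by rewrite -ltr_pdivlMr.
pose l x := lim ((phi : dual E) x @[phi --> G]).
have lP x : (phi : dual E) x @[phi --> G] --> l x := cvGx x.
have ll : linear l.
  move=> a u v; apply: cvg_lim => //.
  under eq_fun do rewrite dualD dualZ.
  by apply: cvgD => //; apply: cvgMr; exact: lP.
(* At each x some phi in the ball has phi x within d of l x, and d is arbitrary. *)
have lball phi0 e : G (ball phi0 e) -> forall x, `|phi0 x - l x| <= e * `|x|.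
  move=> Gphi0 x; apply/ler_addgt0Pr => d d0.
  have /cvgrPdist_lt/(_ d d0) Gd := lP x.
  have [phi []] := filter_ex (filterI Gphi0 Gd).
  rewrite -ball_normE /= => h1 h2.
  have h3 := dual_norm_bound (phi0 - phi) x.
  have -> : phi0 x - l x = (phi0 - phi) x - (l x - phi x).
    by rewrite -[(phi0 - phi) x]/(phi0 x - phi x) opprB addrA subrK.
  apply: le_trans (ler_normB _ _) _; apply: lerD; last exact: ltW.
  by apply: le_trans h3 _; rewrite ler_wpM2r// ltW.
have [phi0 /lball h0] := cG 1 ltr01.
have [Phi PhiE] : exists Phi : dual E, Phi = l :> (E -> R).
  apply: (@bounded_linear_dual _ _ _ (`|phi0| + 1)) => // x.
  have -> : l x = phi0 x - (phi0 x - l x) by rewrite opprB addrC subrK.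
  rewrite mulrDl; apply: le_trans (ler_normB _ _) _; apply: lerD => //.
  exact: dual_norm_bound.
apply/cvg_ex; exists Phi; apply/cvgrPdist_le => e e0.
have e2 : 0 < e / 2 by rewrite divr_gt0.
(* The centre phi1 is within e/2 of the limit, by [lball], and of every phi in its ball. *)
have [phi1 G1] := cG (e / 2) e2.
apply: filterS (G1) => phi; rewrite -ball_normE /= => h.
rewrite -(subrK phi1 Phi) -addrA [e]splitr.
apply: le_trans (ler_normD _ _) _; apply: lerD; last exact: ltW.
apply: dual_norm_le_bound => [|x]; first exact: ltW.
by rewrite -[(Phi - phi1) x]/(Phi x - phi1 x) PhiE distrC; exact: lball.
Qed.

End DualComplete.

(** Makes [dual F] a [completeNormedModType], as required of the space B. *)
HB.instance Definition _ (R : realType) (E : normedModType R) :=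
  Uniform_isComplete.Build (dual E) (@dual_complete R E).

(** * Measurability of limits, and finite linear combinations *)

Lemma measurable_fun_dense d (T : measurableType d) (R : realType)
    (E : normedModType R) (ev : E -> T -> R) (A : set E) :
  (forall t, continuous (ev^~ t)) ->
  (forall a, A a -> measurable_fun setT (ev a)) ->
  (forall v e, 0 < e -> exists2 a, A a & `|v - a| < e) ->
  forall v, measurable_fun setT (ev v).
Proof.
move=> cev mA dA v.
(* Approximants within 1/(n+1) converge to v in norm, hence pointwise in t by [cev]; pointwise
   limits stay measurable. *)
have ex n : exists a, A a /\ `|v - a| < n.+1%:R^-1.
  have [|a Aa va] := dA v n.+1%:R^-1; first by rewrite invr_gt0.
  by exists a.
have [u uP] := choice ex.
have uv : u n @[n --> \oo] --> v.
  apply/cvgrPdist_lt => e e0; near=> n.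
  have [_ /lt_trans] := uP n; apply; near: n.
  exact: (near_infty_natSinv_lt (PosNum e0)).
apply: (@measurable_fun_cvg _ _ _ _ (fun n => ev (u n))) => [n|t _].
  by apply: mA; case: (uP n).
exact: (cvg_comp _ _ uv (cev t v)).
Unshelve. all: by end_near. Qed.

Lemma measurable_lincomb d (T : measurableType d) (R : realType) n
    (c : 'I_n -> R) (f : 'I_n -> T -> R) :
  (forall i, measurable_fun setT (f i)) ->
  measurable_fun setT (\sum_(i < n) c i *: f i).
Proof.
move=> mf; rewrite fct_sumE.
by apply: measurable_sum => i; exact: measurable_funM.
Qed.

(** Coefficients of equal points are added up. The new data come before V and a, so that one choice
    serves both the functionals [eval_at] and the vectors of F. *)
Lemma sum_distinct (R : pzRingType) (X : choiceType) n (x : 'I_n -> X)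
    (c : 'I_n -> R) : exists m (z : 'I_m -> X) (d : 'I_m -> R),
  injective z /\ forall (V : lmodType R) (a : X -> V),
    \sum_(i < n) c i *: a (x i) = \sum_(j < m) d j *: a (z j).
Proof.
pose s := undup (codom x).
pose z (j : 'I_(size s)) := tnth (in_tuple s) j.
have zi : injective z by apply/tuple_uniqP; exact: undup_uniq.
exists (size s), z, (fun j => \sum_(i < n | x i == z j) c i); split=> // V a.
under [RHS]eq_bigr do rewrite scaler_suml.
rewrite (exchange_big_dep predT)//=; apply: eq_bigr => i _.
have xs : (index (x i) s < size s)%N.
  by rewrite index_mem mem_undup codom_f.
have zE : z (Ordinal xs) = x i.
  by rewrite /z (tnth_nth (x i)) nth_index// -index_mem.
move: (Ordinal xs) zE => j0 zE; rewrite (big_pred1 j0) ?zE// => j.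
by rewrite -zE /= (inj_eq zi) eq_sym.
Qed.

Lemma lspan_linear (R : nzRingType) (V : lmodType R) (A : set V) a u v :
  lspan A u -> lspan A v -> lspan A (a *: u + v).
Proof.
move=> [n [c [x [xA ->]]]] [m [d [y [yA ->]]]].
exists (n + m)%N,
  (fun i => match fintype.split i with inl j => a * c j | inr j => d j end),
  (fun i => match fintype.split i with inl j => x j | inr j => y j end); split.
  by move=> i; case: fintype.split.
rewrite big_split_ord scaler_sumr /=; congr (_ + _); apply: eq_bigr => i _.
  by rewrite -[lshift m i]/(unsplit (inl i)) unsplitK scalerA.
by rewrite -[rshift n i]/(unsplit (inr i)) unsplitK.
Qed.

Lemma lspan_rangeP (R : nzRingType) (V : lmodType R) X (a : X -> V) v :
  lspan (range a) v <-> exists n (c : 'I_n -> R) (x : 'I_n -> X),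
    v = \sum_(i < n) c i *: a (x i).
Proof.
split=> [[n [c [y [yA ->]]]]|[n [c [x ->]]]]; last first.
  by exists n, c, (a \o x); split=> // i; exists (x i).
have ex i : exists x, a x = y i by have [x _ <-] := yA i; exists x.
have [x xE] := choice ex; exists n, c, x.
by apply: eq_bigr => i _; rewrite xE.
Qed.

(** * The dual of F as a space of functions on Om *)

Section DualRKBS.
Context {R : realType} {Om Om' : ptopologicalType}.
Variables (K : L0 R (Om * Om')%type) (normK : (Om' -> R) -> R).
Variables (F : completeNormedModType R) (evF : {linear F -> (Om' -> R)}).
Hypothesis F_completion : is_completion_of (kerr_span K) normK evF.
Hypothesis F_eval_continuous :
  forall y : Om', continuous (fun g : F => evF g y).
Variables (k : Om -> F).
Hypothesis kE : forall x, evF (k x) = kerr K x.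

Let evF_inj : injective evF. Proof. by case: F_completion. Qed.

Lemma evF_sum n (c : 'I_n -> R) (x : 'I_n -> Om) :
  evF (\sum_(i < n) c i *: k (x i)) = \sum_(i < n) c i *: kerr K (x i).
Proof. by rewrite linear_sum; apply: eq_bigr => i _; rewrite linearZ /= kE. Qed.

Lemma span_dense (v : F) (e : R) : 0 < e ->
  exists2 a, lspan (range k) a & `|v - a| < e.
Proof.
move=> e0; have [_ _ _ dS] := F_completion.
have [|g [vg]] := dS (ball v e) _ (ball_open v e).
  by exists v; exact: ballxx.
move=> /lspan_rangeP [n [c [x gE]]].
exists g; last by move: vg; rewrite -ball_normE.
by apply/lspan_rangeP; exists n, c, x; apply: evF_inj; rewrite gE evF_sum.
Qed.

(** Repeated points are merged in both sums at once, so distinctness need not be carried along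
    afterwards. *)
Lemma Delta_norm_embed n (c : 'I_n -> R) (x : 'I_n -> Om) :
  Delta_norm K normK (\sum_(i < n) c i *: eval_at (x i)) =
  `|\sum_(i < n) c i *: k (x i)|.
Proof.
have [m [z [d [zi E]]]] := sum_distinct x c.
have [_ _ nE _] := F_completion.
rewrite !E Delta_normE// nE evF_sum//.
by apply/lspan_rangeP; exists m, d, z.
Qed.

Lemma kerr_measurable x : measurable_fun [set: borelType Om'] (kerr K x).
Proof.
move=> _ A mA; rewrite setTI.
have mK : measurable (K @^-1` A).
  by rewrite -[X in measurable X]setTI; exact: measurable_funPT.
have mp : measurable_fun [set: borelType Om']
    ((fun y => (x, y)) : borelType Om' -> borelType (Om * Om')%type).
  apply: (@measurability _ _ (borelType Om') (borelType (Om * Om')%type) _ _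
    (@open (Om * Om')%type)) => //.
  move=> _ [U oU <-]; rewrite setTI; apply: sub_sigma_algebra.
  apply: open_comp oU => y _.
  by apply: cvg_pair => /=; [exact: cvg_cst|exact: cvg_id].
by have := mp measurableT _ mK; rewrite setTI.
Qed.

(** Measurability passes from the sections K(x, .) to all of F by density of their span. *)
Lemma evF_measurable g : measurable_fun [set: borelType Om'] (evF g).
Proof.
apply: (@measurable_fun_dense _ (borelType Om') R F evF (lspan (range k)))
  => //.
  move=> a /lspan_rangeP [n [c [x ->]]]; rewrite evF_sum.
  by apply: measurable_lincomb => i; exact: kerr_measurable.
exact: span_dense.
Qed.

Definition evB (phi : dual F) : Om -> R := fun x => phi (k x).

Lemma evB_linear : linear evB. Proof. by []. Qed.

HB.instance Definition _ :=
  GRing.isLinear.Build R (dual F) (Om -> R) _ evB evB_linear.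

Lemma dual_sum (phi : dual F) n (c : 'I_n -> R) (x : 'I_n -> Om) :
  phi (\sum_(i < n) c i *: k (x i)) = \sum_(i < n) c i * phi (k (x i)).
Proof.
elim/big_ind2 : _ => [|u r v s <- <-|i _]; first exact: dual0.
  exact: dualD.
exact: dualZ.
Qed.

Lemma dual_norm_le_span (phi : dual F) (C : R) : 0 <= C ->
  (forall v, lspan (range k) v -> `|phi v| <= C * `|v|) -> `|phi| <= C.
Proof.
move=> C0 phiC; apply: dual_norm_le_bound => // v.
apply/ler_addgt0Pr => e e0.
(* Replacing v by w costs at most (|phi| + C) |v - w|; the extra 1 keeps the denominator
   positive. *)
have b0 : 0 < `|phi| + C + 1 by rewrite ltr_wpDl// addr_ge0.
have [w kw vw] := span_dense v (divr_gt0 e0 b0).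
have h1 : (`|phi| + C) * `|v - w| <= e.
  apply: (@le_trans _ _ ((`|phi| + C + 1) * (e / (`|phi| + C + 1)))).
    by apply: ler_pM; rewrite ?lerDl ?addr_ge0// ltW.
  by rewrite mulrC divfK// gt_eqF.
have h2 : `|w| <= `|v| + `|v - w|.
  by rewrite -{1}(subKr v w); exact: ler_normB.
have h3 := phiC w kw.
have h4 := dual_norm_bound phi (v - w).
have h5 : `|phi v| <= `|phi w| + `|phi (v - w)|.
  by rewrite dualB -{1}(subrK (phi w) (phi v)) addrC; exact: ler_normD.
have h6 := ler_wpM2l C0 h2.
by rewrite mulrDl in h1; rewrite mulrDr in h6; lra.
Qed.

(** A functional that vanishes at every [k x] vanishes on a dense span. *)
Lemma evB_inj : injective evB.
Proof.
move=> phi psi pq; apply/eqP; rewrite -subr_eq0 -normr_eq0; apply/eqP.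
set th := phi - psi.
have th0 x : th (k x) = 0.
  by rewrite -[LHS]/(phi (k x) - psi (k x)) -[phi _]/(evB phi x) pq subrr.
suff : `|th| <= 0 by rewrite normr_le0 => /eqP ->; rewrite normr0.
apply: dual_norm_le_span => // _ /lspan_rangeP [n [c [x ->]]].
by rewrite mul0r dual_sum big1 ?normr0// => i _; rewrite th0 mulr0.
Qed.

(** Read through [evB], this functional is the function K(., y). *)
Lemma point_evaluation y : exists phi : dual F, forall g, phi g = evF g y.
Proof.
have lf : linear (fun g => evF g y) by move=> a u v; rewrite linearP.
have fP : (fun g => evF g y) \in (@dual_pred R F).
  by rewrite inE /=; split.
by exists (Dual fP).
Qed.

Lemma evB_measurable : reflexive_space F ->
  forall phi, measurable_fun [set: borelType Om] (evB phi).
Proof.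
move=> rF phi.
pose W := [set w : dual F | measurable_fun [set: borelType Om] (evB w)].
apply: (@measurable_fun_dense _ (borelType Om) R (dual F) evB W) => //.
  (* Evaluation at x is the bidual element [J (k x)], hence continuous. *)
  move=> x w; have [J [JE _]] := canonical_embedding F.
  have -> : evB ^~ x = J (k x) by apply/funext => v; rewrite JE.
  exact: dual_continuous.
apply: reflexive_dense => //.
- by exists 0; exact: measurable_cst.
- move=> a u v mu mv; rewrite /W /=.
  apply: (@measurable_funD _ (borelType Om) R setT
    (fun x => a * evB u x) (evB v)) => //.
  by apply: measurable_funM => //; exact: measurable_cst.
(* [W] contains the evaluation at every y, so a v killed by [W] is the zero function. *)
- move=> v vW; apply: evF_inj; rewrite linear0; apply/funext => y.
  have [w wE] := point_evaluation y.
  rewrite -wE; apply: vW; rewrite /W /=.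
  have -> : evB w = kerl K y by apply/funext => x; rewrite /evB wE kE.
  exact: kerl_measurable.
Qed.

Lemma Delta_evalE n (c : 'I_n -> R) (x : 'I_n -> Om) (f : L0 R Om) :
  (\sum_(i < n) c i *: eval_at (x i)) f = \sum_(i < n) c i * f (x i).
Proof. by rewrite fct_sumE. Qed.

Lemma Delta_eval_evB n (c : 'I_n -> R) (x : 'I_n -> Om) (f : L0 R Om)
    (phi : dual F) : evB phi = f ->
  (\sum_(i < n) c i *: eval_at (x i)) f = phi (\sum_(i < n) c i *: k (x i)).
Proof.
by move=> fE; rewrite Delta_evalE dual_sum -fE.
Qed.

Lemma evB_range : reflexive_space F ->
  range evB = [set (f : Om -> R) | f in B_set K normK].
Proof.
move=> rF; apply/seteqP; split=> [_ [phi _ <-]|_ [f [C C0 fC] <-]].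
  pose f : L0 R Om := mfun_Sub (mem_set (evB_measurable rF phi)).
  exists f => //; exists (`|phi| + 1); first by rewrite ltr_wpDl.
  move=> _ /lspan_rangeP [n [c [x ->]]].
  rewrite (@Delta_eval_evB _ _ _ f phi)// Delta_norm_embed.
  apply: le_trans (dual_norm_bound _ _) _.
  by rewrite ler_wpM2r// lerDl.
(* The graph of k x |-> f x on the span; membership of f in [B_set] is the bound that the extension
   requires. *)
pose G : set (F * R) := lspan (range (fun x => (k x, f x))).
have [] := @hahn_banach_dual R F C G (ltW C0).
- by exists 0, 0%N, (fun=> 0), (fun=> 0); split=> [[]//|]; rewrite big_ord0.
- by move=> a u v; exact: lspan_linear.
- move=> _ /lspan_rangeP [n [c [x ->]]].
  rewrite !raddf_sum /= -(Delta_norm_embed c x).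
  rewrite -[X in `|X|]Delta_evalE; apply: fC.
  by apply/lspan_rangeP; exists n, c, x.
move=> phi _ phiG; exists phi => //; apply/funext => x.
apply: (phiG (k x, f x)); apply/lspan_rangeP.
by exists 1%N, (fun=> 1), (fun=> x); rewrite big_ord1 scale1r.
Qed.

Lemma evB_norm (phi : dual F) (f : L0 R Om) : evB phi = f ->
  `|phi| = B_norm K normK f.
Proof.
move=> fE.
have ub n (c : 'I_n -> R) (x : 'I_n -> Om) :
    `|(\sum_(i < n) c i *: eval_at (x i)) f| /
      Delta_norm K normK (\sum_(i < n) c i *: eval_at (x i)) <= `|phi|.
  rewrite (Delta_eval_evB _ _ fE) Delta_norm_embed.
  have := dual_norm_bound phi (\sum_(i < n) c i *: k (x i)).
  (* The inverse of 0 is 0, so the quotient is 0 when v = 0. *)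
  set v := \sum_(i < n) _; have [->|v0] := eqVneq v 0.
    by rewrite normr0 invr0 !mulr0.
  by rewrite ler_pdivrMr ?normr_gt0.
pose Q := [set `|l f| / Delta_norm K normK l |
  l in [set l | Delta l /\ l != 0]].
have Qub : ubound Q `|phi|.
  by move=> _ [l [/lspan_rangeP [n [c [x ->]]] _] <-]; exact: ub.
(* The supremum of an empty [Q] would be 0 by convention. *)
have Q0 : 0 <= sup Q.
  have [Qn|/nonemptyPn ->] := pselect (Q !=set0); last by rewrite sup0.
  have [q Qq] := Qn; apply: (@le_trans _ _ q).
    have [l [/lspan_rangeP [n [c [x ->]]] _] <-] := Qq.
    by rewrite Delta_norm_embed divr_ge0.
  by apply: sup_upper_bound => //; split=> //; exists `|phi|.
apply/eqP; rewrite eq_le; apply/andP; split; last first.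
  have [Qn|/nonemptyPn Q00] := pselect (Q !=set0); first exact: ge_sup.
  by rewrite /B_norm -/Q Q00 sup0.
apply: dual_norm_le_span => // _ /lspan_rangeP [n [c [x ->]]].
set v := \sum_(i < n) _; have [->|v0] := eqVneq v 0.
  by rewrite dual0 !normr0 mulr0.
have Qv : Q (`|phi v| / `|v|).
  exists (\sum_(i < n) c i *: eval_at (x i)); last first.
    by rewrite (Delta_eval_evB _ _ fE) Delta_norm_embed.
  split; first by apply/lspan_rangeP; exists n, c, x.
  (* A zero lambda has the norm of the empty sum, which is 0, and that norm is |v|; [point] only
     fills a function on an empty index type. *)
  apply: contra_neq v0 => l0; apply: normr0_eq0.
  have := @Delta_norm_embed 0 (fun=> 0) (fun=> point).
  by rewrite !big_ord0 normr0 -l0 Delta_norm_embed.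
rewrite -ler_pdivrMr ?normr_gt0//; apply: sup_upper_bound => //.
  by split; [exists (`|phi v| / `|v|)|exists `|phi|].
Qed.

End DualRKBS.

Theorem proposition2p13 (R : realType) (Om Om' : ptopologicalType)
  (Om_hausdorff : hausdorff_space Om) (Om_lc : locally_compact [set: Om])
  (Om'_hausdorff : hausdorff_space Om') (Om'_lc : locally_compact [set: Om'])
  (mu : {measure set (borelType Om) -> \bar R}) (mu_regular : regular_borel mu)
  (mu' : {measure set (borelType Om') -> \bar R})
  (mu'_regular : regular_borel mu')
  (K : L0 R (Om * Om')%type) (K_li : kerr_linear_independent K)
  (normK : (Om' -> R) -> R) (normK_norm : is_norm_on (kerr_span K) normK)
  (F : completeNormedModType R) (evF : {linear F -> (Om' -> R)})
  (F_completion : is_completion_of (kerr_span K) normK evF)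
  (F_reflexive : reflexive_space F)
  (F_eval_continuous : forall y : Om', continuous (fun g : F => evF g y)) :
  exists (B : completeNormedModType R) (evB : {linear B -> (Om -> R)}),
    [/\ range evB = [set (f : Om -> R) | f in B_set K normK],
        forall (b : B) (f : L0 R Om),
          evB b = (f : Om -> R) -> `|b| = B_norm K normK f,
        two_sided_RKBS K evB evF &
        isometrically_equivalent (dual B) F].
Proof.
have [evF_inj kerr_range _ _] := F_completion.
have ex x : exists g, evF g = kerr K x.
  have [|g _ <-] := kerr_range (kerr K x); last by exists g.
  apply/lspan_rangeP; exists 1%N, (fun=> 1), (fun=> x).
  by rewrite big_ord1 scale1r.
have [k kE] := choice ex.
have [J [JE Jn]] := canonical_embedding F.
have Jiso : is_isometric_iso J.
  (* Surjectivity is reflexivity; injectivity follows from preservation of the norm. *)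
  split=> //; have surj Phi : exists v, J v = Phi.
    have [v vE] := F_reflexive Phi; exists v.
    by apply/val_inj/funext => phi; rewrite /= vE; exact: JE.
  have [g Jg] := choice surj; exists g => // v.
  apply/eqP; rewrite -subr_eq0 -normr_eq0 -Jn linearB /= Jg subrr normr0.
  exact: eqxx.
exists (dual F), (evB k : {linear dual F -> (Om -> R)}); split.
- exact: (evB_range F_completion F_eval_continuous kE F_reflexive).
- exact: (evB_norm F_completion kE).
- split.
  + split; first exact: (evB_inj F_completion kE).
    exact: (evB_measurable F_completion F_eval_continuous kE F_reflexive).
  + split=> //; exact: (evF_measurable F_completion F_eval_continuous kE).
  (* The dual of B is the bidual of F, identified with F by [J], so the pairing of f with g is the
     value f g. *)
  + exists J => //; split.
    * exact: ex.
    * move=> f x g gE; rewrite JE /= /evB; congr (f _); apply: evF_inj.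
      by rewrite gE kE.
    * move=> y; have [phi phiE] := point_evaluation F_eval_continuous y.
      by exists phi; apply/funext => x; rewrite /= /evB phiE kE.
    * move=> g y f fE; rewrite JE.
      (* By injectivity of [evB], f is the evaluation at y. *)
      have [phi phiE] := point_evaluation F_eval_continuous y.
      rewrite -phiE; congr (dual_fun _ g); apply: (evB_inj F_completion kE).
      by rewrite [LHS]fE; apply/funext => x; rewrite /evB phiE kE.
- exact: (isometric_iso_inverse Jiso).
Qed.
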